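(* Let $X$ be a locally compact, non-compact Hausdorff space, with one-point compactification $\alpha X = X \cup \{\star\}$. Then $\alpha X$ is radial at $\star$ if and only if for every $Y \subseteq X$ whose closure in $X$ is non-compact, there exist a non-compact $Z \in \overline{\mathbf{Sp}}^\infty(X)$ and a cofinal chain $(K_\alpha)_{\alpha < \lambda}$ in $(\mathcal{K}(Z), \subseteq)$, indexed increasingly by an ordinal $\lambda$, such that $K_\alpha = \overline{K_\alpha \cap Y}$ for all $\alpha < \lambda$ (closure in $X$).
   Context: A transfinite sequence is a net whose domain is (nonempty and) well-ordered. A space $W$ is radial at $w$ if for every $A \subseteq W$ with $w \in \overline{A}$ there is a transfinite sequence with range in $A$ converging to $w$. A spoke at a point $w$ of $W$ is a subspace $S \ni w$ of $W$ such that $w$ has, in $S$, a neighbourhood base well-ordered by $\supseteq$. $\star$ denotes the point at infinity of the one-point compactification $\alpha X$. A set $S \subseteq X$ is a spoke at infinity of $X$ if $S \cup \{\star\}$ is a spoke at $\star$ in $\alpha X$; $\overline{\mathbf{Sp}}^\infty(X)$ is the set of spokes at infinity that are closed in $X$. $\mathcal{K}(Z)$ is the set of compact subsets of $Z$. $(K_\alpha)_{\alpha<\lambda}$ is a cofinal chain in $(\mathcal{K}(Z),\subseteq)$ if each $K_\alpha \in \mathcal{K}(Z)$, $K_\alpha \subseteq K_\beta$ whenever $\alpha \le \beta < \lambda$, and each $K \in \mathcal{K}(Z)$ is contained in some $K_\alpha$. *)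

(* Defs.v *)
From mathcomp Require Import all_boot all_classical.
From mathcomp Require Import topology.
From mathcomp Require wochoice.

Set Implicit Arguments.
Unset Strict Implicit.
Unset Printing Implicit Defensive.

Local Open Scope classical_set_scope.

(* For R : rel I, the relation R i j reads "i <= j".  Ordinals are represented
   by well-ordered types (I, R). *)
Definition tails (I : Type) (R : rel I) : set_system I :=
  filter_from [set: I] (fun i => [set j | R i j]).

Definition radial_at (W : topologicalType) (w : W) : Prop :=
  forall A : set W, closure A w ->
    exists (I : Type) (R : rel I) (x : I -> W),
      [/\ inhabited I, wochoice.well_order R, range x `<=` A &
          x @ tails R --> w].

(* The carrier of subspace S is all of W, so that a neighbourhood of w in
   subspace S may have points outside S; the requirement U `<=` S discards
   these, leaving the neighbourhoods of w in S as sets of points of S. *)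
Definition nbhs_base_in (W : topologicalType) (S : set W) (w : W)
    (B : set (set W)) : Prop :=
  (forall U, B U -> U `<=` S /\ nbhs (w : subspace S) U) /\
  (forall V, nbhs (w : subspace S) V -> exists2 U, B U & U `<=` V).

Definition superset_rel (T : Type) : rel (set T) :=
  fun U V => `[< V `<=` U >].

Definition is_spoke (W : topologicalType) (w : W) (S : set W) : Prop :=
  S w /\ exists2 B : set (set W),
    nbhs_base_in S w B & wochoice.wo_chain (@superset_rel W) (mem B).

Definition is_spoke_at_infinity (X : topologicalType) (S : set X) : Prop :=
  @is_spoke (one_point_compactification X) None (Some @` S `|` [set None]).

Definition closed_spokes_at_infinity (X : topologicalType) : set (set X) :=
  [set S | is_spoke_at_infinity S /\ closed S].

Definition compacts_of (X : topologicalType) (Z : set X) : set (set X) :=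
  [set K | K `<=` Z /\ compact K].

Definition cofinal_chain (X : topologicalType) (Z : set X)
    (I : Type) (R : rel I) (K : I -> set X) : Prop :=
  [/\ forall i, compacts_of Z (K i),
      forall i j, R i j -> K i `<=` K j &
      forall L, compacts_of Z L -> exists i, L `<=` K i].

(* Main.v *)
(* Call a transfinite sequence in X escaping if it eventually leaves every
   compact set, i.e. if it converges to the point at infinity.  Given Y with
   non-compact closure, radiality yields an escaping sequence (x_i) in Y, which
   we take of minimal order type.  Then {x_k | k < b} has compact closure K_b for
   every b: otherwise radiality applied to this set yields an escaping sequence
   of values x_k, k < b, and it can be reindexed along an initial segment of b,
   against minimality.  By local compactness the K_b are cofinal among the
   compact subsets of Z = closure {x_i}, and their complements in Z, with the
   point at infinity added, form the neighbourhood base of a spoke.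
   Conversely, a cofinal chain with K_i = closure (K_i & Y) in a non-compact Z has
   no last term, so one can choose x_i in (Z & Y) \ K_i, and (x_i) escapes. *)
Require Import Defs.
From mathcomp Require Import all_boot all_classical.
From mathcomp Require Import topology.
From mathcomp Require wochoice.

Local Open Scope classical_set_scope.

Set Implicit Arguments.
Unset Strict Implicit.

(** * Well-orders *)

Section WellOrder.
Context (I : Type) (R : rel I).
Hypothesis wR : wochoice.well_order R.

Lemma well_order_min (P : set I) : P !=set0 ->
  exists2 m, P m & forall j, P j -> R m j.
Proof.
move=> [i Pi]; have [|m [[mP lbm] _]] := @wR (fun i => i \in P).
  by exists i; exact: mem_set.
exists m; first exact: set_mem.
by move=> j Pj; apply: lbm; exact: mem_set.
Qed.

Lemma well_order_refl i : R i i.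
Proof.
by have [|m -> ] := well_order_min (P := [set i]); [exists i | exact].
Qed.

Lemma well_order_total i j : R i j || R j i.
Proof.
have [|m [] -> h] := well_order_min (P := [set i; j]); first by exists i; left.
- by rewrite h //; right.
- by rewrite orbC h //; left.
Qed.

(** [wochoice.well_order] asks for a unique minimum, and here both points are minima of the pair. *)
Lemma well_order_anti i j : R i j -> R j i -> i = j.
Proof.
move=> Rij Rji.
have [|m [_ um]] := @wR (fun k => k \in [set i; j]).
  by exists i; apply: mem_set; left.
rewrite -(um i) ?(um j) //; split; try by apply: mem_set; [left|right].
- by apply: mem_set; right.
- by move=> k /set_mem[] ->; rewrite ?well_order_refl.
- by apply: mem_set; left.
- by move=> k /set_mem[] ->; rewrite ?well_order_refl.
Qed.

(** The least of the three points decides: when it is [j] or [k], antisymmetry makes two of them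
    equal. *)
Lemma well_order_trans j i k : R i j -> R j k -> R i k.
Proof.
move=> Rij Rjk.
have [|m + h] := well_order_min (P := [set i; j; k]); first by exists i; left; left.
move: h => /[swap] -[[]|] -> h.
- by apply: h; right.
- by rewrite (well_order_anti Rij) //; apply: h; left; left.
- by rewrite -(well_order_anti Rjk) //; apply: h; left; right.
Qed.

Lemma well_order_ltW i j : ~~ R j i -> R i j.
Proof. by move=> /negbTE ji; have := well_order_total i j; rewrite ji orbF. Qed.

Lemma well_order_sig (D : set I) :
  wochoice.well_order (fun a b : {i | D i} => R (sval a) (sval b)).
Proof.
apply: wochoice.antisymmetric_well_order.
  move=> [a Da] [b Db] /= /andP[ab ba]; apply: eq_exist.
  exact: well_order_anti.
move=> A [a aA].
have [|m [Dm mA] lb] := well_order_min (P := [set i | exists Di, exist D i Di \in A]).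
  by case: a aA => i Di aA; exists i, Di.
by exists (exist D m Dm); split=> // -[j Dj] jA /=; apply: lb; exists Dj.
Qed.

(** [F] may repeat values. Among the sets of a subfamily, the one with the least index is the
    largest, hence first for [superset_rel]. *)
Lemma wo_chain_range (T : Type) (F : I -> set T) :
  (forall i j, R i j -> F j `<=` F i) ->
  wochoice.wo_chain (@superset_rel T) (mem (range F)).
Proof.
move=> antiF; apply: wochoice.antisymmetric_wo_chain.
  move=> U V _ _ /andP[/asboolP VU /asboolP UV].
  by apply/seteqP.
move=> A sA [U UA].
have [|m mA lb] := well_order_min (P := [set i | F i \in A]).
  by have /set_mem[i _ Fi] := sA _ UA; exists i; rewrite /= Fi.
exists (F m); split=> // V VA; have /set_mem[j _ Fj] := sA _ VA.
by apply/asboolP; rewrite -Fj; apply/antiF/lb; rewrite /= Fj.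
Qed.

End WellOrder.

(** * Escape to infinity *)

(** [D] singles out the indices in use, so that cutting down to an initial segment keeps the index
    type and its order. *)
Definition escapes (X : topologicalType) (I : Type) (R : rel I) (D : set I)
    (x : I -> X) :=
  forall C, compact C -> exists2 i, D i & forall j, D j -> R i j -> ~ C (x j).

Lemma escapes_inh (X : topologicalType) (I : Type) (R : rel I) (D : set I)
  (x : I -> X) : escapes R D x -> D !=set0.
Proof. by move=> /(_ _ compact0)[i Di _]; exists i. Qed.

(** Complements of closed compact sets give the neighbourhoods of infinity, and compact sets are
    closed in a Hausdorff space. *)
Lemma cvg_infty_escapes (X : topologicalType) (I : Type) (R : rel I)
    (x : I -> X) : hausdorff_space X ->
  (fun i => Some (x i) : one_point_compactification X) @ tails R -->
    (None : one_point_compactification X) <-> escapes R setT x.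
Proof.
move=> hH; split.
  move=> xN C cC.
  have /xN[i _ iC] : nbhs (None : one_point_compactification X)
      (Some @` (~` C) `|` [set None]).
    by exists C => //; split=> //; exact: compact_closed.
  by exists i => // j _ /iC[[z Cz [<-]]|].
move=> esc U [C [cC _] CU]; have [i _ iC] := esc C cC.
by exists i => // j Rij; apply: CU; left; exists (x j) => //; exact: iC.
Qed.

Lemma closure_infty (X : topologicalType) (Y : set X) :
  hausdorff_space X ->
  @closure (one_point_compactification X) (Some @` Y) None <->
  ~ compact (closure Y).
Proof.
move=> hH; split.
  move=> clY cY.
  have [] := clY (Some @` (~` closure Y) `|` [set None]).
    by exists (closure Y) => //; split=> //; exact: closed_closure.
  move=> _ [[y Yy <-] [[z nYz [zy]]|//]]; apply: nYz; rewrite zy.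
  exact: subset_closure.
(* If [U] missed [Y], then [Y] would lie in the closed compact set [C], and so would its closure. *)
move=> ncY U [C [cC clC] CU]; apply: contrapT => UY; apply: ncY.
apply: (subclosed_compact _ cC); first exact: closed_closure.
rewrite (closure_id C).1 //; apply: closureS => y Yy.
apply: contrapT => nCy; apply: UY; exists (Some y).
by split; [exists y | apply: CU; left; exists y].
Qed.

Lemma radial_escapes (X : topologicalType) (Y : set X) : hausdorff_space X ->
  @radial_at (one_point_compactification X) None -> ~ compact (closure Y) ->
  exists (I : Type) (R : rel I) (x : I -> X),
    [/\ wochoice.well_order R, forall i, Y (x i) & escapes R setT x].
Proof.
move=> hH rad /(closure_infty _ hH)/rad[I [R [x [_ wR xY xN]]]].
have /choice[z zP] : forall i, exists z, Y z /\ Some z = x i.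
  by move=> i; have [|z Yz zx] := xY (x i); [exists i | exists z].
exists I, R, z; split=> // [i|]; first by have [] := zP i.
apply/cvg_infty_escapes => //.
by rewrite (_ : (fun i => _) = x) //; apply/funext => i; have [] := zP i.
Qed.

(* If g k bounds the indices j with y j = x k, then g is unbounded on
   {k | k < b}, since every y j is some x k.  With b' least such that g is
   unbounded on {k | k < b'}, some h a dominates g on {k | k <= a} for each
   a < b', and y o h escapes along {a | a < b'}. *)
Lemma escapes_reindex (X : topologicalType) (I J : Type) (R : rel I)
    (S : rel J) (b : I) (x : I -> X) (y : J -> X) :
  wochoice.well_order R -> wochoice.well_order S ->
  (forall j, exists2 k, ~~ R b k & y j = x k) -> escapes S setT y ->
  exists b' (t : I -> X), [/\ R b' b, range t `<=` range y &
    escapes R [set k | ~~ R b' k] t].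
Proof.
move=> wR wS yx escy.
have /choice[g gP] : forall k, exists g, forall j, S g j -> y j <> x k.
  move=> k; have [j _ jP] := escy _ (@compact_set1 _ (x k)).
  by exists j => i ji; exact: jP.
have [|b' b'P b'min] := @well_order_min I R wR
    [set a | forall j, exists2 k, ~~ R a k & S j (g k)].
  exists b => j; have [k kb yk] := yx j; exists k => //.
  by apply: well_order_ltW => //; apply/negP => /gP.
have /choice[h hP] : forall a, exists j, ~~ R b' a ->
    forall k, R k a -> S (g k) j.
  move=> a; have [ba|ba] := boolP (R b' a); first by exists (g a).
  have [j jP] : exists j, forall k, ~~ R a k -> S (g k) j.
    apply: contrapT => nj; move/negP: ba; apply; apply: b'min => j.
    apply: contrapT => nk; apply: nj; exists j => k ak.
    by apply: well_order_ltW => //; apply/negP => jk; apply: nk; exists k.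
  (* [jP] covers only the [k] strictly below [a]; the larger of [j] and [g a] covers [a] as well. *)
  have [jg|gj] := orP (well_order_total wS j (g a)).
  - exists (g a) => _ k ka; have [ak|ak] := boolP (R a k).
      by rewrite (well_order_anti wR ka ak) well_order_refl.
    by apply: (well_order_trans wS (j := j)) => //; exact: jP.
  - exists j => _ k ka; have [ak|ak] := boolP (R a k); last exact: jP.
    by rewrite (well_order_anti wR ka ak).
exists b', (y \o h); split.
- apply: b'min => j; have [k kb yk] := yx j; exists k => //.
  by apply: well_order_ltW => //; apply/negP => /gP.
- by move=> _ [a _ <-]; exists (h a).
- move=> C cC; have [j0 _ j0P] := escy C cC; have [k kb jk] := b'P j0.
  exists k => // a ab ka; apply: j0P => //.
  by apply: (well_order_trans wS (j := g k)) => //; exact: hP.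
Qed.

Lemma radial_thin_escapes (X : topologicalType) (Y : set X) :
  hausdorff_space X ->
  @radial_at (one_point_compactification X) None -> ~ compact (closure Y) ->
  exists (I : Type) (R : rel I) (D : set I) (x : I -> X),
    [/\ wochoice.well_order R,
        forall b k, D b -> R k b -> D k,
        forall i, Y (x i), escapes R D x &
        forall b, D b -> compact (closure (x @` [set k | ~~ R b k]))].
Proof.
move=> hH rad ncY.
have [I [R [x0 [wR x0Y escx0]]]] := radial_escapes hH rad ncY.
pose P b := exists2 t : I -> X, forall i, Y (t i) &
  escapes R [set k | ~~ R b k] t.
have [D [x [Ddown xY escx Dmin]]] : exists (D : set I) (x : I -> X),
    [/\ forall b k, D b -> R k b -> D k, forall i, Y (x i), escapes R D x &
        forall b, D b -> ~ P b].
  (* The segment below the least [b] with [P b] has minimal order type; if there is no such [b], all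
     of [I] serves. *)
  have [exP|nP] := pselect (exists b, P b); last first.
    by exists setT, x0; split=> // b _ Pb; apply: nP; exists b.
  have [i [x xY escx] imin] := well_order_min wR exP.
  exists [set k | ~~ R i k], x; split=> //.
    by move=> b k /= ib kb; apply: contra ib => ik; exact: (well_order_trans wR ik).
  by move=> b /negP ib /imin.
exists I, R, D, x; split=> // b Db.
(* Otherwise some [y] with values among the [x k], [k < b], escapes; reindexing it yields [P b'] for
   some [b'] in [D], against [Dmin]. *)
apply: contrapT => /(radial_escapes hH rad)[J [S [y [wS yx escy]]]].
have yx' j : exists2 k, ~~ R b k & y j = x k.
  by have [k kb <-] := yx j; exists k.
have [b' [t [b'b ty esct]]] := escapes_reindex wR wS yx' escy.
apply: (Dmin b'); first exact: Ddown b'b.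
exists t => // i; have [|j _ <-] := ty (t i); first by exists i.
by have [k _ <-] := yx j.
Qed.

(** * Spokes from cofinal chains *)

Lemma spoke_of_cofinal_chain (X : topologicalType) (Z : set X) (I : Type)
    (R : rel I) (K : I -> set X) :
  hausdorff_space X -> closed Z -> wochoice.well_order R ->
  cofinal_chain Z R K -> is_spoke_at_infinity Z.
Proof.
move=> hH clZ wR [Kc Kmono Kcof]; split; first by right.
exists (range (fun i => Some @` (Z `\` K i) `|` [set None])); last first.
  apply: (wo_chain_range wR) => i j Rij; apply: setSU; apply: image_subset.
  by apply: setDS; exact: Kmono.
split=> [_ [i _ <-]|V].
  split; first by apply: setSU; apply: image_subset => z [].
  rewrite nbhs_subspace_ex; last by right.
  exists (Some @` (~` K i) `|` [set None]).
    have [_ cK] := Kc i.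
    by exists (K i) => //; split=> //; exact: compact_closed.
  apply/seteqP; split=> [_ [[[z [Zz nK] <-]|->] _]|_ [[[z nK <-]|->] ZS]].
  - by split; left; exists z.
  - by split; right.
  - case: ZS => [[z' Zz' [zz']]|//]; rewrite -zz' in nK *.
    by split; left; exists z'.
  - by split; right.
rewrite nbhs_subspace_ex; last by right.
move=> [W [C [cC clC] CW] VW].
(* [Z] is closed, so its trace on the compact set [C] is compact and cofinality applies. *)
have [i CKi] : exists i, Z `&` C `<=` K i.
  by apply: Kcof; split=> //; rewrite setIC; exact: compact_closedI.
exists (Some @` (Z `\` K i) `|` [set None]); first by exists i.
move=> o oU; suff : (V `&` (Some @` Z `|` [set None])) o by case.
rewrite VW; case: oU => [[z [Zz nK] <-]|->]; split; try by [right]; last first.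
- by apply: CW; right.
- by left; exists z.
- by apply: CW; left; exists z => // Cz; apply: nK; exact: CKi.
Qed.

(** * From cofinal chains to radiality *)

Lemma radial_at_infty (X : topologicalType) : hausdorff_space X ->
  (forall Y : set X, ~ compact (closure Y) ->
    exists Z : set X,
      [/\ closed_spokes_at_infinity Z, ~ compact Z &
        exists (I : Type) (R : rel I) (K : I -> set X),
          [/\ wochoice.well_order R, cofinal_chain Z R K &
            forall i, K i = closure (K i `&` Y)]]) ->
  @radial_at (one_point_compactification X) None.
Proof.
move=> hH H A clA; have [AN|nAN] := pselect (A None).
  (* When infinity itself lies in [A], a constant sequence of length one converges to it. *)
  exists unit, (fun _ _ => true), (fun=> None); split.
  - by split.
  - by apply: wochoice.antisymmetric_well_order => [[] []|B [[] B0]] //; exists tt.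
  - by move=> _ [_ _ <-].
  - by move=> U /nbhs_singleton UN; exists tt.
have AE : A = Some @` (Some @^-1` A).
  apply/seteqP; split=> [[z|] Az //|_ [z Az <-] //]; by exists z.
move: clA; rewrite {1}AE => /(closure_infty _ hH)/H.
move=> [Z [[_ clZ] ncZ [I [R [K [wR [Kc Kmono Kcof] KY]]]]]].
have /choice[x xP] : forall i, exists x, [/\ A (Some x), Z x & ~ K i x].
  (* Otherwise every [K j] meets [Y], the trace of [A] on [X], inside [K i]; taking closures puts
     [K j] in [K i]. The [K j] cover [Z], so [Z = K i] would be compact. *)
  move=> i; apply: contrapT => nx; apply: ncZ.
  have [KZ cK] := Kc i; suff -> : Z = K i by [].
  apply/seteqP; split=> // z Zz.
  have [j zj] : exists j, [set z] `<=` K j.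
    by apply: Kcof; split; [move=> _ ->|exact: compact_set1].
  suff : K j `<=` K i by apply; exact: zj.
  rewrite (KY j) (closure_id (K i)).1; last exact: compact_closed.
  apply: closureS => y [Ky Ay]; apply: contrapT => nKy.
  by apply: nx; exists y; split=> //; have [+ _] := Kc j; exact.
exists I, R, (fun i => Some (x i)); split=> //.
- by have [i _] := Kcof set0 (conj (@sub0set _ _) (@compact0 _)); exists.
- by move=> _ [i _ <-]; have [] := xP i.
apply/cvg_infty_escapes => // C cC.
have [i CKi] : exists i, Z `&` C `<=` K i.
  by apply: Kcof; split=> //; rewrite setIC; exact: compact_closedI.
exists i => // j _ Rij Cx; have [_ Zx] := xP j; apply.
by apply: (Kmono i) => //; exact: CKi.
Qed.

(** * From radiality to cofinal chains *)

Lemma radial_cofinal_chain (X : topologicalType) (Y : set X) :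
  locally_compact [set: X] -> hausdorff_space X ->
  @radial_at (one_point_compactification X) None -> ~ compact (closure Y) ->
  exists Z : set X,
    [/\ closed_spokes_at_infinity Z, ~ compact Z &
      exists (I : Type) (R : rel I) (K : I -> set X),
        [/\ wochoice.well_order R, cofinal_chain Z R K &
          forall i, K i = closure (K i `&` Y)]].
Proof.
move=> hlc hH rad /(radial_thin_escapes hH rad).
move=> [I [R [D [x [wR Ddown xY escx cK]]]]].
pose K (b : {i | D i}) := closure (x @` [set k | ~~ R (sval b) k]).
pose Z := closure (x @` D).
have chK : cofinal_chain Z (fun a b : {i | D i} => R (sval a) (sval b)) K.
  split=> [[b Db]|[a Da] [b Db] /= ab|L [LZ cL]].
  - split; last exact: cK.
    apply: closureS; apply: image_subset => k /= bk.
    exact: (Ddown b) (well_order_ltW wR bk).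
  - apply: closureS; apply: image_subset => k /=.
    by apply: contra => /(well_order_trans wR ab).
  (* Each [p] in [L] has a compact neighbourhood [C], which [x] leaves from some index [i] on. For
     [b] beyond [i], points of [L] near [p] are limits of values [x k] in [C], hence with [k < b],
     and so lie in [K b]. Compactness of [L] yields one [b] for all [p]. *)
  - pose S (a b : {i | D i}) := R (sval a) (sval b).
    have FS : Filter (tails S).
      apply: filter_from_filter => [|a b _ _].
        by have [i Di] := escapes_inh escx; exists (exist D i Di).
      have [ab|ba] := orP (well_order_total wR (sval a) (sval b)).
        by exists b => // c bc; split=> //; exact: (well_order_trans wR ab).
      by exists a => // c ac; split=> //; exact: (well_order_trans wR ba).
    have [|b _ bL] := (compact_near_coveringP L).1 cL _ (tails S)
        (fun b q => L q -> K b q) FS.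
      move=> p Lp; have [C] := hlc p Logic.I; rewrite withinET => pC [cC _].
      have [i Di iC] := escx C cC.
      exists (C°, [set b | S (exist D i Di) b]) => /=.
        split; first exact: nbhs_interior.
        by exists (exist D i Di).
      move=> [q [b Db]] [/= Cq ib] Lq V Vq.
      have [_ [[k Dk <-] [Vx Cx]]] := LZ q Lq (V `&` C) (filterI Vq Cq).
      exists (x k); split=> //; exists k => //=; apply/negP => bk.
      by apply: (iC k) => //; exact: (well_order_trans wR ib).
    by exists b => q Lq; exact: (bL b (well_order_refl wR (sval b)) q Lq Lq).
have wD := well_order_sig wR (D := D).
have clZ : closed Z by exact: closed_closure.
exists Z; split.
- by split=> //; exact: spoke_of_cofinal_chain chK.
(* A compact [Z] would be left by [x] from some [i] on, yet [x i] lies in [Z]. *)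
- move=> /escx[i Di /(_ i Di (well_order_refl wR i))]; apply.
  by apply: subset_closure; exists i.
- exists {i | D i}, (fun a b => R (sval a) (sval b)), K; split=> // b.
  apply/seteqP; split.
    apply: closureS => _ [k bk <-]; split; last exact: xY.
    by apply: subset_closure; exists k.
  rewrite [X in _ `<=` X](closure_id _).1; last exact: closed_closure.
  by apply: closureS => ? [].
Qed.

Unset Implicit Arguments.

Theorem theorem2p5 (X : topologicalType)
    (hlc : locally_compact [set: X]) (hH : hausdorff_space X)
    (hnc : ~ compact [set: X]) :
  @radial_at (one_point_compactification X) None <->
  (forall Y : set X, ~ compact (closure Y) ->
    exists Z : set X,
      [/\ closed_spokes_at_infinity Z, ~ compact Z &
        exists (I : Type) (R : rel I) (K : I -> set X),
          [/\ wochoice.well_order R, cofinal_chain Z R K &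
            forall i, K i = closure (K i `&` Y)]]).
Proof.
split; last exact: radial_at_infty.
by move=> rad Y; exact: radial_cofinal_chain.
Qed.
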